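(* Let $n=3$ and let $X_1,X_2,X_3$ be a random sample from the gamma distribution with density $g(x)=xe^{-x}$, $x>0$. Then the cumulative distribution function $G$ of $T=\bar X/S$ is given by $$G(t)=\begin{cases}1-\dfrac{10\pi(4t^2-3)}{27\sqrt3\,t^4}, & t\ge\sqrt2,\\[2ex] \dfrac{\sqrt{2-t^2}\,(-33t^4-13t^2+8)+5\pi t(4t^2-3)-30t(4t^2-3)\arcsin\left(\frac{t}{\sqrt2}\right)}{27\sqrt3\,t^5}+1, & \dfrac{\sqrt2}{2}\le t\le\sqrt2.\end{cases}$$
   Context: A random sample is a collection of independent identically distributed random variables. For a sample $X_1,\dots,X_n$, $\bar X=\frac1n\sum_{i=1}^n X_i$ is the sample mean, $S^2=\frac1n\sum_{i=1}^n (X_i-\bar X)^2$ is the biased sample variance, and $S=\sqrt{S^2}$. *)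

(* Defs.v *)
From HB Require Import structures.
From mathcomp Require Export all_boot all_order all_algebra.
From mathcomp Require Export all_classical all_reals all_analysis.
From mathcomp Require Export measurable_realfun.
Export Order.TTheory GRing.Theory Num.Theory.
Export numFieldNormedType.Exports.

#[export] Set Implicit Arguments.
#[export] Unset Strict Implicit.
#[export] Unset Printing Implicit Defensive.

Local Open Scope classical_set_scope.
Local Open Scope ring_scope.

Section random_sample.
Context d (T : measurableType d) (R : realType) (P : probability T R).

Definition mutually_independent (I : finType) (X : I -> {RV P >-> R}) : Prop :=
  forall (J : {set I}) (A : I -> set R),
    (forall i, measurable (A i)) ->
    P (\bigcap_(i in [set` J]) (X i @^-1` A i))
    = (\prod_(i in J) P (X i @^-1` A i))%E.

Definition identically_distributed (I : finType) (X : I -> {RV P >-> R}) :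
    Prop :=
  forall (i j : I) (A : set R),
    measurable A -> distribution P (X i) A = distribution P (X j) A.

Definition random_sample (n : nat) (X : 'I_n -> {RV P >-> R}) : Prop :=
  mutually_independent X /\ identically_distributed X.

Definition has_density (Y : {RV P >-> R}) (f : R -> R) : Prop :=
  forall A : set R, measurable A ->
    distribution P Y A = (\int[lebesgue_measure]_(x in A) (f x)%:E)%E.

Section statistics.
Context (n : nat) (X : 'I_n -> {RV P >-> R}).

Definition sample_mean (w : T) : R := (\sum_(i < n) X i w) / n%:R.

(* Biased: normalised by n, not n - 1. *)
Definition sample_variance (w : T) : R :=
  (\sum_(i < n) (X i w - sample_mean w) ^+ 2) / n%:R.

Definition sample_sd (w : T) : R := Num.sqrt (sample_variance w).

(* Takes the value 0 where the sample standard deviation vanishes, since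
   0^-1 = 0; for a sample of size at least 2 with a density, this is a null
   event. *)
Definition mean_sd_ratio (w : T) : R := sample_mean w / sample_sd w.

Lemma measurable_sample_mean : measurable_fun setT sample_mean.
Proof.
apply: measurable_funM; last exact: measurable_cst.
by apply: measurable_sum => i; exact: measurable_funPT.
Qed.

Lemma measurable_sample_variance : measurable_fun setT sample_variance.
Proof.
apply: measurable_funM; last exact: measurable_cst.
apply: measurable_sum => i; apply: measurable_funX; apply: measurable_funB.
  exact: measurable_funPT.
exact: measurable_sample_mean.
Qed.

Lemma measurable_sample_sd : measurable_fun setT sample_sd.
Proof.
have msqrt : measurable_fun setT (@Num.sqrt R).
  by apply: continuous_measurable_fun; exact: sqrt_continuous.
exact: measurableT_comp msqrt measurable_sample_variance.
Qed.

Lemma measurable_mean_sd_ratio : measurable_fun setT mean_sd_ratio.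
Proof.
apply: measurable_funM; first exact: measurable_sample_mean.
under eq_fun do rewrite -powR_inv1 ?sqrtr_ge0//.
exact: measurableT_comp (measurable_powR (-1)) measurable_sample_sd.
Qed.

HB.instance Definition _ :=
  isMeasurableFun.Build _ _ _ _ mean_sd_ratio measurable_mean_sd_ratio.

End statistics.
End random_sample.

(* Gamma distribution with shape 2 and rate 1. *)
Definition gamma21_pdf (R : realType) (x : R) : R :=
  if 0 < x then x * expR (- x) else 0.

(* Main.v *)
(**
By scale invariance, the event T > t only concerns the barycentric coordinates
(X_1, X_2, X_3) / (X_1 + X_2 + X_3), and says that they lie in the disc of
radius 1 / (sqrt 3 t) around the centre of the triangle. By exchangeability,
P(T > t) is three times the probability that moreover X_1 is the strict minimum,
which confines the point to a sector of angle 2 pi / 3 facing one side of the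
triangle. That side lies t / sqrt 2 radii away from the centre, whereas the
circle meets the edges of the sector half a radius away in that direction. So
for t >= sqrt 2 / 2 both cases of the formula are one integral over the part of
the sector at distance at most min (1, t / sqrt 2) radii in that direction.

The substitution x = s w, y = s ((1 - w) / 2 + h), z = s ((1 - w) / 2 - h)
splits off the factor 120, the integral of s^5 e^-s; with w = (1 - k y) / 3 and
k = sqrt 2 / t, the remaining double integral reduces to elementary primitives.
*)
From HB Require Import structures.
Require Import Defs.
From mathcomp Require Import ring lra.

Local Open Scope classical_set_scope.
Local Open Scope ring_scope.

(** * Integration against a measure with density *)

Section density.
Import HBNNSimple.

(** [nuE] settles indicators, additivity settles simple functions, and monotone convergence along
    [nnsfun_approx] settles every nonnegative measurable [f]. *)
Lemma ge0_integral_density d (T : measurableType d) (R : realType)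
    (nu mu : {measure set T -> \bar R}) (g : T -> R) :
  measurable_fun setT g -> (forall x, 0 <= g x) ->
  (forall A, measurable A -> nu A = (\int[mu]_(x in A) (g x)%:E)%E) ->
  forall f : T -> \bar R, measurable_fun setT f -> (forall x, 0 <= f x)%E ->
  (\int[nu]_x f x = \int[mu]_x (f x * (g x)%:E))%E.
Proof.
move=> mg g0 nuE f mf f0.
have mg' : measurable_fun setT (EFin \o g) by exact/measurable_EFinP.
pose f_ := nnsfun_approx measurableT mf.
have f_f x : (f_ n x)%:E @[n --> \oo] --> f x.
  by apply: (cvg_nnsfun_approx measurableT mf).
have ndf x : nondecreasing_seq (fun n => (f_ n x)%:E).
  by move=> m n mn; rewrite lee_fin; exact/lefP/nd_nnsfun_approx.
transitivity (limn (fun n => \int[nu]_x (f_ n x)%:E))%E.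
  rewrite -monotone_convergence//.
  - by apply: eq_integral => y _; apply/esym/cvg_lim.
  - by move=> n; exact/measurable_EFinP.
  - by move=> n y _; rewrite lee_fin.
transitivity (limn (fun n => \int[mu]_x ((f_ n x)%:E * (g x)%:E)))%E;
  last first.
  rewrite -monotone_convergence//.
  - apply: eq_integral => y _; apply/cvg_lim => //.
    by apply: cvgeZr => //.
  - by move=> n; apply: emeasurable_funM => //; exact/measurable_EFinP.
  - by move=> n y _; rewrite mule_ge0// lee_fin.
  - by move=> x _ m n mn; apply: lee_wpmul2r; [rewrite lee_fin|exact: ndf].
congr (limn _); apply/funext => n.
transitivity (\sum_(k \in range (f_ n))
    \int[nu]_x (k * \1_(f_ n @^-1` [set k]) x)%:E)%E.
  under eq_integral do rewrite fimfunE -fsumEFin//.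
  rewrite ge0_integral_fsum//.
  - by move=> y; exact/measurable_EFinP/measurable_funM.
  - by move=> y x _; rewrite nnfun_muleindic_ge0.
transitivity (\sum_(k \in range (f_ n))
    \int[mu]_x ((k * \1_(f_ n @^-1` [set k]) x)%:E * (g x)%:E))%E; last first.
  rewrite -ge0_integral_fsum//.
  - apply: eq_integral => x _; rewrite [in RHS]fimfunE -fsumEFin//.
    rewrite ge0_mule_fsuml// => k; exact: nnfun_muleindic_ge0.
  - move=> y; apply: emeasurable_funM => //.
    exact/measurable_EFinP/measurable_funM.
  - by move=> y x _; rewrite mule_ge0 ?nnfun_muleindic_ge0 ?lee_fin.
apply: eq_fsbigr => r; rewrite inE => -[x _ <-].
rewrite integralZl_indic_nnsfun// integral_indic// setIT.
rewrite nuE// integral_mkcond.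
rewrite -ge0_integralZl_EFin//.
- apply: eq_integral => y _; rewrite EFinM -muleA; congr (_ * _)%E.
  rewrite patchE indicE; case: ifP => _; rewrite ?mul1e ?mul0e//.
- by move=> y _; apply: erestrict_ge0 => z _; rewrite lee_fin.
- by apply/(measurable_restrictT _ _).1 => //; exact: measurable_funTS.
Qed.

End density.

(* [lebesgue_measure] lives on [measurableTypeR R], whose display differs from
   that of [R]; pushing [nu] forward by the identity reconciles the two. *)
Lemma ge0_integral_lebesgue_density (R : realType)
    (nu : {measure set R -> \bar R}) (g : R -> R) :
  measurable_fun setT g -> (forall x, 0 <= g x) ->
  (forall A : set R, measurable A ->
    nu A = (\int[lebesgue_measure]_(x in A) (g x)%:E)%E) ->
  forall f : R -> \bar R, measurable_fun setT f -> (forall x, 0 <= f x)%E ->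
  (\int[nu]_x f x = \int[lebesgue_measure]_x (f x * (g x)%:E))%E.
Proof.
move=> mg g0 nuE f mf f0.
pose idR : R -> measurableTypeR R := idfun.
have midR : measurable_fun setT idR by move=> _ A mA; rewrite setTI.
pose nu' := (pushforward nu idR :
  {measure set (measurableTypeR R) -> \bar R}).
rewrite -(@ge0_integral_density _ (measurableTypeR R) R (nu' midR)
  lebesgue_measure g mg g0 nuE f mf f0).
by rewrite (ge0_integral_pushforward midR)// preimage_setT.
Qed.

(** * Affine substitution on the line *)

(** By uniqueness of Lebesgue measure it is enough to compare both sides, as measures in [A], on
    half-open intervals. *)
Lemma lebesgue_measure_affine (R : realType) (a b : R) (A : set R) :
  a != 0 -> measurable A ->
  (lebesgue_measure A =
   `|a|%:E * lebesgue_measure ((fun x => (a * x + b)%R) @^-1` A))%E.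
Proof.
move=> a0 mA.
have ma0 : 0 < `|a| by rewrite normr_gt0.
pose phi : measurableTypeR R -> measurableTypeR R := fun x => a * x + b.
have mphi : measurable_fun setT phi.
  by apply: measurable_funD => //; exact: measurable_funM.
pose nu := mscale (NngNum (ltW ma0)) (pushforward lebesgue_measure phi)
  : {measure set (measurableTypeR R) -> \bar R}.
suff : lebesgue_measure A = nu mphi A by [].
apply: lebesgue_measure_unique => // _ [[u v]] _ <-.
rewrite /nu /= /mscale /= /pushforward /=.
have [an|ap|a00] := ltgtP a 0; last by rewrite a00 eqxx in a0.
  (* A negative slope reverses the interval, so the preimage is closed on the left and open on the
     right. *)
  rewrite (_ : phi @^-1` _ = `[(v - b) / a, (u - b) / a[%classic).
    rewrite !lebesgue_measure_itv/= !lte_fin.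
    rewrite ltr_nM2r ?invr_lt0// ltrD2r; case: ifPn => _; last by rewrite mule0.
    by rewrite ltr0_norm// -!EFinD -EFinM; congr EFin; field.
  apply/seteqP; split => x /=; rewrite /phi !in_itv/= ler_ndivrMr// ltr_ndivlMr//.
    by move=> /andP[? ?]; apply/andP; split; lra.
  by move=> /andP[? ?]; apply/andP; split; lra.
rewrite (_ : phi @^-1` _ = `](u - b) / a, (v - b) / a]%classic).
  rewrite !lebesgue_measure_itv/= !lte_fin.
  rewrite ltr_pM2r ?invr_gt0// ltrD2r; case: ifPn => _; last by rewrite mule0.
  by rewrite gtr0_norm// -!EFinD -EFinM; congr EFin; field.
apply/seteqP; split => x /=; rewrite /phi !in_itv/= ltr_pdivrMr// ler_pdivlMr//.
  by move=> /andP[? ?]; apply/andP; split; lra.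
by move=> /andP[? ?]; apply/andP; split; lra.
Qed.

Lemma ge0_integral_affine (R : realType) (a b : R) (f : R -> \bar R) :
  a != 0 -> measurable_fun setT f -> (forall x, 0 <= f x)%E ->
  (\int[lebesgue_measure]_x f x =
   `|a|%:E * \int[lebesgue_measure]_x f (a * x + b)%R)%E.
Proof.
move=> a0 mf f0.
have ma0 : 0 < `|a| by rewrite normr_gt0.
pose phi : measurableTypeR R -> measurableTypeR R := fun x => a * x + b.
have mphi : measurable_fun setT phi.
  by apply: measurable_funD => //; exact: measurable_funM.
pose nu := pushforward lebesgue_measure phi
  : {measure set (measurableTypeR R) -> \bar R}.
have := @ge0_integral_pushforward _ _ _ _ R _ mphi lebesgue_measure setT f
  measurableT mf (fun x _ => f0 x).
rewrite preimage_setT => <-.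
rewrite -(ge0_integral_mscale (nu mphi) measurableT
  (NngNum (ltW ma0)))//.
apply: eq_measure_integral => //= A mA _.
exact: lebesgue_measure_affine.
Qed.

(** * Joint law of three independent variables *)

(** A cardinality count. Keeping the enumeration arbitrary lets the later lemmas put any of the
    three variables first. *)
Lemma mem_uniq3 (i j k : 'I_3) : uniq [:: i; j; k] -> [:: i; j; k] =i 'I_3.
Proof.
move=> u; apply/subset_cardP; first by rewrite (card_uniqP u) card_ord.
exact: subset_predT.
Qed.

Lemma mutually_independent3 d (T : measurableType d) (R : realType)
    (P : probability T R) (X : 'I_3 -> {RV P >-> R}) (i j k : 'I_3)
    (A B C : set R) :
  mutually_independent X -> uniq [:: i; j; k] ->
  measurable A -> measurable B -> measurable C ->
  (P (X i @^-1` A `&` X j @^-1` B `&` X k @^-1` C) =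
   P (X i @^-1` A) * P (X j @^-1` B) * P (X k @^-1` C))%E.
Proof.
move=> indX uijk mA mB mC.
have ijkE := mem_uniq3 uijk.
move: (uijk) => /=; rewrite !inE negb_or andbT => /andP[/andP[ij ik] jk].
(* [S] packs the three sets into the indexed family that [mutually_independent] asks for, used with
   all of ['I_3] as index set. *)
pose S l := if l == i then A else if l == j then B else C.
have Si : S i = A by rewrite /S eqxx.
have Sj : S j = B by rewrite /S eq_sym (negbTE ij) eqxx.
have Sk : S k = C by rewrite /S eq_sym (negbTE ik) eq_sym (negbTE jk).
have mS l : measurable (S l) by rewrite /S; case: ifP => // _; case: ifP.
have := indX [set: 'I_3]%SET S mS.
rewrite (eq_bigl (mem [:: i; j; k])); last first.
  by move=> l; have := ijkE l; rewrite !inE => h; symmetry; exact: h.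
rewrite -big_uniq//= !big_cons big_nil mule1 Si Sj Sk muleA => <-.
congr (P _); apply/seteqP; split => w /=.
  move=> [[wA wB] wC] l _; have := ijkE l; rewrite !inE.
  by case/or3P => /eqP ->; rewrite ?Si ?Sj ?Sk.
move=> h; split; first split.
- by rewrite -Si; apply: h; rewrite /= inE.
- by rewrite -Sj; apply: h; rewrite /= inE.
- by rewrite -Sk; apply: h; rewrite /= inE.
Qed.

Lemma measurable_triple d (T : measurableType d) (R : realType)
    (P : probability T R) (X Y Z : {RV P >-> R}) :
  measurable_fun setT (fun w => (X w, Y w, Z w)).
Proof.
by do 2 (apply: measurable_fun_pair; last exact: measurable_funPT);
  exact: measurable_funPT.
Qed.

Lemma product_probability3E d1 d2 d3 (T1 : measurableType d1)
    (T2 : measurableType d2) (T3 : measurableType d3) (R : realType)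
    (P1 : probability T1 R) (P2 : probability T2 R) (P3 : probability T3 R)
    (A : set (T1 * T2 * T3)) : measurable A ->
  (((P1 \x P2) \x P3) A =
   \int[P1]_x \int[P2]_y \int[P3]_z (\1_A (x, y, z))%:E)%E.
Proof.
move=> mA.
have mA1 : measurable_fun setT (EFin \o (\1_A : _ -> R)).
  exact/measurable_EFinP.
have A0 x : (0 <= (EFin \o (\1_A : _ -> R)) x)%E by rewrite lee_fin.
have := @indic_fubini_tonelli_FE _ _ _ _ R P3 A.
rewrite /product_measure1 => <-.
rewrite (@fubini_tonelli1 _ _ _ _ R P1 P2)//.
- exact: (@measurable_fun_fubini_tonelli_F _ _ _ _ R P3 _ mA1 A0).
- by move=> x; apply: integral_ge0 => y _; rewrite lee_fin.
- exact: mA.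
Qed.

(** Uniqueness of product measures is applied twice: to the first two coordinates with the event on
    the third held fixed, then to this pair and the third coordinate. *)
Lemma joint_law3 d (T : measurableType d) (R : realType)
    (P : probability T R) (X : 'I_3 -> {RV P >-> R}) (i j k : 'I_3)
    (A : set (R * R * R)) :
  mutually_independent X -> uniq [:: i; j; k] -> measurable A ->
  (P [set w | A (X i w, X j w, X k w)] =
   \int[distribution P (X i)]_x \int[distribution P (X j)]_y
     \int[distribution P (X k)]_z (\1_A (x, y, z))%:E)%E.
Proof.
move=> indX uijk mA.
have mX2 : measurable_fun setT (fun w => (X i w, X j w)).
  by apply/measurable_fun_pairP; split; exact: measurable_funPT.
have mX3 := measurable_triple (X i) (X j) (X k).
pose Pi : probability R R := distribution P (X i).
pose Pj : probability R R := distribution P (X j).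
pose Pk : probability R R := distribution P (X k).
have law3 B C : measurable B -> measurable C ->
    (P [set w | B (X i w, X j w) /\ C (X k w)] = (Pi \x Pj) B * Pk C)%E.
  move=> mB mC.
  pose mXC := measurable_funPTI (X k) mC.
  (* The probability of the fixed event is absorbed as a scalar into the law of the first
     coordinate, so that the restricted measure is again a product. *)
  pose c : {nonneg R} := NngNum (fine_ge0 (measure_ge0 P (X k @^-1` C))).
  have cE : (c%:num%:E = P (X k @^-1` C))%E.
    by rewrite /= fineK// fin_num_measure.
  pose nu := (pushforward (mrestr P mXC) (fun w => (X i w, X j w)) :
      {measure set (R * R) -> \bar R}).
  have := @product_measure_unique _ _ _ _ R (mscale c Pi) Pj (nu mX2).
  move=> /(_ _ B mB) h.
  transitivity ((mscale c Pi \x Pj) B)%E.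
    rewrite h// => A1 A2 mA1 mA2.
    rewrite /nu /= /mscale /pushforward /mrestr /Pi /Pj /distribution cE.
    rewrite /pushforward.
    rewrite -[RHS]muleA [RHS]muleC.
    rewrite -(mutually_independent3 indX uijk mA1 mA2 mC).
    by congr (P _); apply/seteqP; split => w /=; tauto.
  rewrite /product_measure1 ge0_integral_mscale//.
  - by rewrite cE muleC.
  - exact: measurable_fun_xsection.
pose nu := (pushforward P (fun w => (X i w, X j w, X k w)) :
      {measure set (R * R * R) -> \bar R}).
pose Pij : probability (R * R)%type R := (Pi \x Pj)%E.
have := @product_measure_unique _ _ _ _ R Pij Pk (nu mX3) law3 _ mA.
rewrite /nu /= /pushforward => <-.
exact: product_probability3E.
Qed.

(** * The gamma density and threefold integrals *)

Lemma measurable_gamma21_pdf (R : realType) :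
  measurable_fun setT (@gamma21_pdf R).
Proof.
apply: measurable_fun_ifT => //.
- exact: measurable_fun_ltr.
- apply: measurable_funM => //.
  by apply: measurableT_comp => //; exact: measurable_expR.
Qed.

Lemma gamma21_pdf_ge0 (R : realType) (x : R) : 0 <= gamma21_pdf x.
Proof.
by rewrite /gamma21_pdf; case: ifP => // /ltW x0; rewrite mulr_ge0// expR_ge0.
Qed.

Section integral3.
Context (R : realType).
Local Notation mu := (@lebesgue_measure R).
Implicit Type f : R * R * R -> \bar R.
Local Open Scope ereal_scope.

Let measurable_section f x : measurable_fun setT f ->
  measurable_fun setT (fun q : R * R => f (x, q.1, q.2)).
Proof.
move=> mf; apply: (measurableT_comp mf).
apply: measurable_fun_pair => //; exact: measurable_fun_pair.
Qed.

(** Tonelli exchanges y with z, then x with z. This brings the sum of the three variables outermost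
    once it has replaced the last one. *)
Lemma ge0_integral3_rot f : measurable_fun setT f -> (forall p, 0 <= f p) ->
  \int[mu]_x \int[mu]_y \int[mu]_z f (x, y, z) =
  \int[mu]_z \int[mu]_x \int[mu]_y f (x, y, z).
Proof.
move=> mf f0.
transitivity (\int[mu]_x \int[mu]_z \int[mu]_y f (x, y, z)).
  apply: eq_integral => x _.
  by rewrite (@fubini_tonelli _ _ _ _ R mu mu (fun q => f (x, q.1, q.2)))//;
    exact: measurable_section.
pose h (q : R * R) := \int[mu]_y f (q.1, y, q.2).
rewrite (@fubini_tonelli _ _ _ _ R mu mu h)//.
- apply: (@measurable_fun_fubini_tonelli_F _ _ _ _ R mu
    (fun p => f (p.1.1, p.2, p.1.2))) => //.
  apply: (measurableT_comp mf); apply: measurable_fun_pair.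
    apply: measurable_fun_pair => //.
    by apply: measurableT_comp.
  by apply: measurableT_comp.
- by move=> q; apply: integral_ge0.
Qed.

(** The laws are replaced by densities from the innermost outwards; the outer factors are then moved
    under the inner integrals. *)
Lemma ge0_integral3_density f (nu1 nu2 nu3 : probability R R) (g : R -> R) :
  measurable_fun setT f -> (forall p, 0 <= f p) ->
  measurable_fun setT g -> (forall x, 0 <= g x)%R ->
  (forall A, measurable A -> nu1 A = \int[mu]_(x in A) (g x)%:E) ->
  (forall A, measurable A -> nu2 A = \int[mu]_(x in A) (g x)%:E) ->
  (forall A, measurable A -> nu3 A = \int[mu]_(x in A) (g x)%:E) ->
  \int[nu1]_x \int[nu2]_y \int[nu3]_z f (x, y, z) =
  \int[mu]_x \int[mu]_y \int[mu]_z (f (x, y, z) * (g x * g y * g z)%:E).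
Proof.
move=> mf f0 mg g0 nu1E nu2E nu3E.
have meg : measurable_fun setT (EFin \o g) by exact/measurable_EFinP.
have eg0 x : 0 <= (g x)%:E by rewrite lee_fin.
have mf3 : measurable_fun setT (fun p => f p * (g p.2)%:E).
  apply: emeasurable_funM => //; exact: measurableT_comp meg _.
have f30 p : 0 <= f p * (g p.2)%:E by rewrite mule_ge0.
have mf2 : measurable_fun setT
    (fun q : R * R => (\int[mu]_z (f (q, z) * (g z)%:E)) * (g q.2)%:E).
  apply: emeasurable_funM => //; last exact: measurableT_comp meg _.
  exact: (@measurable_fun_fubini_tonelli_F _ _ _ _ R mu _ mf3).
have f20 (q : R * R) : 0 <= (\int[mu]_z (f (q, z) * (g z)%:E)) * (g q.2)%:E.
  by rewrite mule_ge0// integral_ge0// => z _; exact: (f30 (q, z)).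
have nu3P x y : \int[nu3]_z f (x, y, z) = \int[mu]_z (f (x, y, z) * (g z)%:E).
  rewrite (ge0_integral_lebesgue_density mg g0 nu3E)//.
  exact: measurableT_comp mf _.
have nu23P x : \int[nu2]_y \int[nu3]_z f (x, y, z) =
    \int[mu]_y ((\int[mu]_z (f (x, y, z) * (g z)%:E)) * (g y)%:E).
  under eq_integral do rewrite nu3P.
  rewrite (ge0_integral_lebesgue_density mg g0 nu2E)//.
  - apply: (measurableT_comp
      (f := fun q => \int[mu]_z (f (q, z) * (g z)%:E))) => //.
    exact: (@measurable_fun_fubini_tonelli_F _ _ _ _ R mu _ mf3).
  - by move=> y; rewrite integral_ge0// => z _; exact: (f30 (x, y, z)).
under eq_integral do rewrite nu23P.
rewrite (ge0_integral_lebesgue_density mg g0 nu1E)//; first last.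
- by move=> x; apply: integral_ge0 => y _; exact: (f20 (x, y)).
- exact: (@measurable_fun_fubini_tonelli_F _ _ _ _ R mu _ mf2).
apply: eq_integral => x _.
rewrite -ge0_integralZr//; first last.
- exact: measurableT_comp mf2 _.
apply: eq_integral => y _.
have mz : measurable_fun setT (fun z => f (x, y, z) * (g z)%:E).
  exact: measurableT_comp mf3 _.
have z0 z : 0 <= f (x, y, z) * (g z)%:E by exact: (f30 (x, y, z)).
rewrite -ge0_integralZr// -ge0_integralZr//.
- apply: eq_integral => z _; rewrite -!muleA -!EFinM; congr (_ * _%:E).
  by ring.
- exact: emeasurable_funM.
- by move=> z _; rewrite mule_ge0.
Qed.

End integral3.

(** * The cone and its scaling *)

(* The event T > t together with [x] being the strict minimum; strictness rules
   out a vanishing standard deviation, where T is the junk value [0]. *)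
Definition cone (R : realType) (t : R) (p : R * R * R) : bool :=
  let: (x, y, z) := p in
  [&& x < y, x < z, 0 < x + y + z &
      t ^+ 2 * (3 * (x ^+ 2 + y ^+ 2 + z ^+ 2) - (x + y + z) ^+ 2)
        < (x + y + z) ^+ 2].

Lemma measurable_cone (R : realType) (t : R) :
  measurable_fun setT (cone t : R * R * R -> bool).
Proof.
have -> : cone t = fun p : R * R * R =>
  [&& p.1.1 < p.1.2, p.1.1 < p.2, 0 < p.1.1 + p.1.2 + p.2 &
      t ^+ 2 * (3 * (p.1.1 ^+ 2 + p.1.2 ^+ 2 + p.2 ^+ 2)
                - (p.1.1 + p.1.2 + p.2) ^+ 2)
        < (p.1.1 + p.1.2 + p.2) ^+ 2].
  by apply/funext => -[[x y] z].
have m1 : measurable_fun setT (fun p : R * R * R => p.1.1).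
  exact: measurableT_comp.
have m2 : measurable_fun setT (fun p : R * R * R => p.1.2).
  exact: measurableT_comp.
have m3 : measurable_fun setT (fun p : R * R * R => p.2).
  exact: measurable_snd.
have ms : measurable_fun setT (fun p : R * R * R => p.1.1 + p.1.2 + p.2).
  exact (measurable_funD (measurable_funD m1 m2) m3).
have mq : measurable_fun setT (fun p : R * R * R =>
    p.1.1 ^+ 2 + p.1.2 ^+ 2 + p.2 ^+ 2).
  by apply: measurable_funD; [apply: measurable_funD|]; exact: measurable_funX.
have mv : measurable_fun setT (fun p : R * R * R => t ^+ 2 *
    (3 * (p.1.1 ^+ 2 + p.1.2 ^+ 2 + p.2 ^+ 2) - (p.1.1 + p.1.2 + p.2) ^+ 2)).
  apply: measurable_funM => //.
  apply: measurable_funB; last exact (measurable_funX 2 ms).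
  by apply: measurable_funM.
apply: measurable_and; first exact (measurable_fun_ltr m1 m2).
apply: measurable_and; first exact (measurable_fun_ltr m1 m3).
apply: measurable_and.
  exact (measurable_fun_ltr (measurable_cst (0 : R)) ms).
exact (measurable_fun_ltr mv (measurable_funX 2 ms)).
Qed.

(** The first three conditions are homogeneous of degree one and the last of degree two, so a
    positive factor cancels. *)
Lemma cone_scale (R : realType) (t s x y z : R) : 0 < s ->
  cone t (s * x, s * y, s * z) = cone t (x, y, z).
Proof.
move=> s0; rewrite /cone !ltr_pM2l// -!mulrDr pmulr_rgt0//.
congr [&& _, _, _ & _]; rewrite !exprMn.
rewrite -[X in X < _](_ : s ^+ 2 * (t ^+ 2 *
  (3 * (x ^+ 2 + y ^+ 2 + z ^+ 2) - (x + y + z) ^+ 2)) = _); last by ring.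
by rewrite ltr_pM2l// exprn_gt0.
Qed.

(* The product of the three densities on the plane x + y + z = 1, up to the factor
   e^-1 and restricted to [cone], in the coordinates x = w,
   y = (1 - w) / 2 + h, z = (1 - w) / 2 - h. *)
Definition simplex_density (R : realType) (t w h : R) : R :=
  if (0 < w) && cone t (w, h + (1 - w) / 2, (1 - w) / 2 - h)
  then w * ((1 - w) ^+ 2 / 4 - h ^+ 2) else 0.

Lemma simplex_density_ge0 (R : realType) (t w h : R) :
  0 <= simplex_density t w h.
Proof.
rewrite /simplex_density; case: ifP => // /andP[w0 /and4P[wy wz _ _]].
rewrite (_ : _ - _ = (h + (1 - w) / 2) * ((1 - w) / 2 - h)); last by field.
by rewrite mulr_ge0 ?(ltW w0)// mulr_ge0// ltW// (lt_trans w0).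
Qed.

Definition cone_density (R : realType) (t : R) (p : R * R * R) : R :=
  (cone t p)%:R *
  (gamma21_pdf p.1.1 * gamma21_pdf p.1.2 * gamma21_pdf p.2).

Lemma cone_density_ge0 (R : realType) (t : R) (p : R * R * R) :
  0 <= cone_density t p.
Proof. by rewrite mulr_ge0// !mulr_ge0// gamma21_pdf_ge0. Qed.

Lemma measurable_cone_density (R : realType) (t : R) :
  measurable_fun setT (cone_density t).
Proof.
have mg := @measurable_gamma21_pdf R.
apply: measurable_funM.
  have -> : (fun x : R * R * R => (cone t x)%:R : R) =
      (fun x : R * R * R => if cone t x then 1 else 0).
    by apply/funext => p; case: (cone t p).
  apply: measurable_fun_ifT => //; exact: measurable_cone.
apply: measurable_funM; first apply: measurable_funM.
- by apply: (measurableT_comp mg); exact: measurableT_comp.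
- by apply: (measurableT_comp mg); exact: measurableT_comp.
- exact: (measurableT_comp mg measurable_snd).
Qed.

(** The three linear factors give s^3, and the exponentials merge because the coordinates sum to
    [s]. The third coordinate is [s] minus the other two, the form in which the shift to the sum
    produces it. *)
Lemma cone_density_scale (R : realType) (t s w h : R) : 0 < s ->
  cone_density t (s * w, s * h + s * ((1 - w) / 2),
                  s - s * w - (s * h + s * ((1 - w) / 2))) =
  s ^+ 3 * expR (- s) * simplex_density t w h.
Proof.
move=> s0; rewrite /cone_density /simplex_density -mulrDr.
rewrite (_ : s - s * w - _ = s * ((1 - w) / 2 - h)); last by field.
rewrite cone_scale//; set c := cone t _.
have cw : c -> w < h + (1 - w) / 2 /\ w < (1 - w) / 2 - h by case/and4P.
(* For w <= 0 both sides vanish, the left one through the first gamma factor. *)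
clearbody c; rewrite /=; have [w0|w0] := ltP 0 w; last first.
  by rewrite /gamma21_pdf pmulr_rgt0// [0 < w]ltNge w0/= !mul0r !mulr0.
case: ifPn => [/= /[dup] cT /cw[wy wz]|/= /negbTE->]; last first.
  by rewrite mul0r mulr0.
rewrite cT mul1r /gamma21_pdf !pmulr_rgt0//.
rewrite w0 (lt_trans w0 wy) (lt_trans w0 wz).
have -> : expR (- s) = expR (- (s * w)) * expR (- (s * (h + (1 - w) / 2)))
    * expR (- (s * ((1 - w) / 2 - h))).
  by rewrite -!expRD; congr expR; field.
by field.
Qed.

Lemma measurable_simplex_density (R : realType) (t : R) :
  measurable_fun setT (fun q : R * R => simplex_density t q.1 q.2).
Proof.
(* Taking s = 1 in [cone_density_scale] lets measurability be inherited from [cone_density]. *)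
have -> : (fun q : R * R => simplex_density t q.1 q.2) =
    (fun q => (1 ^+ 3 * expR (- 1))^-1 * cone_density t (1 * q.1,
      1 * q.2 + 1 * ((1 - q.1) / 2),
      1 - 1 * q.1 - (1 * q.2 + 1 * ((1 - q.1) / 2)))).
  apply/funext => -[w h]; rewrite cone_density_scale//.
  by rewrite mulKf// mulf_neq0 ?expf_neq0// gt_eqF// expR_gt0.
have mh : measurable_fun setT (fun q : R * R => 1 * q.2 + 1 * ((1 - q.1) / 2)).
  apply: measurable_funD; first by apply: measurable_funM.
  apply: measurable_funM => //; apply: measurable_funM => //.
  exact: measurable_funB.
have mw : measurable_fun setT (fun q : R * R => 1 * q.1).
  by apply: measurable_funM.
apply: measurable_funM => //.
apply: (measurableT_comp (@measurable_cone_density R t)).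
apply: measurable_fun_pair; first exact: measurable_fun_pair.
by apply: measurable_funB => //; exact: measurable_funB.
Qed.

Section cone_mass.
Context (R : realType).
Local Notation mu := (@lebesgue_measure R).
Local Open Scope ereal_scope.

(** Replacing z by s = x + y + z and then scaling the plane at height s separates s from w and h:
    s^3 comes from the densities and s^2 from the area. *)
Lemma cone_mass_simplex (t : R) :
  \int[mu]_x \int[mu]_y \int[mu]_z (cone_density t (x, y, z))%:E =
  (\int[mu]_(s in `]0%R, +oo[) (s ^+ 5 * expR (- s))%:E) *
  \int[mu]_w \int[mu]_h (simplex_density t w h)%:E.
Proof.
pose F : R * R * R -> \bar R := EFin \o cone_density t.
have mF : measurable_fun setT F.
  by apply/measurable_EFinP; exact: measurable_cone_density.
have F0 p : 0 <= F p by rewrite lee_fin cone_density_ge0.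
pose G (p : R * R * R) := F (p.1.1, p.1.2, p.2 - p.1.1 - p.1.2)%R.
have m11 : measurable_fun setT (fun p : R * R * R => p.1.1).
  exact: measurableT_comp.
have m12 : measurable_fun setT (fun p : R * R * R => p.1.2).
  exact: measurableT_comp.
have mG : measurable_fun setT G.
  apply: (measurableT_comp mF).
  exact (measurable_fun_pair (measurable_fun_pair m11 m12)
    (measurable_funB (measurable_funB measurable_snd m11) m12)).
have G0 p : 0 <= G p by exact: F0.
transitivity (\int[mu]_x \int[mu]_y \int[mu]_s G (x, y, s)).
  apply: eq_integral => x _; apply: eq_integral => y _.
  rewrite (@ge0_integral_affine R 1 (- x - y))//.
  - rewrite normr1 mul1e; apply: eq_integral => s _.
    by rewrite /G/= mul1r addrA.
  - exact: measurableT_comp mF _.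
  - by move=> z; exact: (F0 (x, y, z)).
rewrite (ge0_integral3_rot mG G0).
have sd0 w h : 0 <= (simplex_density t w h)%:E.
  by rewrite lee_fin simplex_density_ge0.
have inner s : (0 < s)%R -> \int[mu]_x \int[mu]_y G (x, y, s) =
    (s ^+ 5 * expR (- s))%:E * \int[mu]_w \int[mu]_h (simplex_density t w h)%:E.
  move=> s0; have s_neq0 : s != 0%R by rewrite gt_eqF.
  have mGx x : measurable_fun setT (fun y => G (x, y, s)).
    by apply: (measurableT_comp mG); exact: measurable_fun_pair.
  have mGs : measurable_fun setT (fun x => \int[mu]_y G (x, y, s)).
    apply: (@measurable_fun_fubini_tonelli_F _ _ _ _ R mu
      (fun q => G (q, s))) => //.
    by apply: (measurableT_comp mG); exact: measurable_fun_pair.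
  have msd :
      measurable_fun setT (fun q : R * R => (simplex_density t q.1 q.2)%:E).
    by apply/measurable_EFinP; exact: measurable_simplex_density.
  (* Each substitution contributes one factor [s]: x = s w here, y = s h + s (1 - w) / 2 below. *)
  rewrite (@ge0_integral_affine R s 0)//; last by move=> x; exact: integral_ge0.
  have -> : (s ^+ 5 * expR (- s))%:E = `|s|%:E * (s ^+ 4 * expR (- s))%:E.
    by rewrite -EFinM gtr0_norm//; congr EFin; ring.
  rewrite -muleA; congr (_ * _); rewrite -ge0_integralZl//; last 3 first.
  - exact: (@measurable_fun_fubini_tonelli_F _ _ _ _ R mu _ msd
      (fun q => sd0 q.1 q.2)).
  - by move=> w _; exact: integral_ge0.
  - by rewrite lee_fin mulr_ge0 ?exprn_ge0 ?expR_ge0// ltW.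
  apply: eq_integral => w _; rewrite addr0.
  rewrite (@ge0_integral_affine R s (s * ((1 - w) / 2)))//.
  have -> : (s ^+ 4 * expR (- s))%:E = `|s|%:E * (s ^+ 3 * expR (- s))%:E.
    by rewrite -EFinM gtr0_norm//; congr EFin; ring.
  rewrite -muleA; congr (_ * _); rewrite -ge0_integralZl//; last 2 first.
  - exact (measurableT_comp msd (pair1_measurable w)).
  - by rewrite lee_fin mulr_ge0 ?exprn_ge0 ?expR_ge0// ltW.
  apply: eq_integral => h _.
  by rewrite /G /F/= cone_density_scale// EFinM.
rewrite -ge0_integralZr//; last 3 first.
- apply/measurable_EFinP; apply: measurable_funM; first exact: measurable_funX.
  apply: measurable_funTS; apply: measurableT_comp => //; exact: measurable_expR.
- move=> s; rewrite /= in_itv/= andbT => s0.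
  by rewrite lee_fin mulr_ge0 ?expR_ge0 ?exprn_ge0// ltW.
- by apply: integral_ge0 => w _; exact: integral_ge0.
rewrite [RHS]integral_mkcond; apply: eq_integral => s _.
rewrite patchE; case: ifPn => [|].
  by rewrite inE/= in_itv/= andbT; exact: inner.
(* For s <= 0 the condition on the sum in [cone] fails, so the integrand vanishes. *)
rewrite notin_setE/= in_itv/= andbT => /negP; rewrite -leNgt => s0.
apply: integral0_eq => x _; apply: integral0_eq => y _.
rewrite /G /F /cone_density /cone /=.
rewrite [X in [&& _, _, X & _]](_ : _ = false) ?andbF ?mul0r//.
by apply/negbTE; rewrite -leNgt; lra.
Qed.
End cone_mass.

(** * Explicit integrals and arcsine values *)

(** From e^x >= x^(n+1) / (n+1)! for x > 0, the expression is at most (n+1)! / x. *)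
Lemma cvg_exprMexpRN (R : realType) (n : nat) :
  (x ^+ n * expR (- x) : R) @[x --> +oo] --> (0 : R).
Proof.
apply/cvgrPdist_le => /= e e0; near=> x.
have x0 : 0 < x by near: x; exact: nbhs_pinfty_gt.
rewrite sub0r normrN ger0_norm ?mulr_ge0 ?exprn_ge0 ?expR_ge0// ?(ltW x0)//.
rewrite expRN ler_pdivrMr ?expR_gt0//.
have fx : n.+1`!%:R / e <= x by near: x; apply: nbhs_pinfty_ge; exact: num_real.
have f0 : (0 : R) < n.+1`!%:R by rewrite ltr0n fact_gt0.
apply: (@le_trans _ _ (e * (x ^+ n.+1 / n.+1`!%:R))); last first.
  rewrite ler_pM2l// (le_trans _ (expR_ge1Dxn n (ltW x0)))// lerDr.
  exact: ler01.
rewrite mulrA ler_pdivlMr// mulrC exprS mulrA ler_pM2r ?exprn_gt0//.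
by rewrite mulrC -ler_pdivrMr.
Unshelve. all: by end_near. Qed.

Lemma integral_x5_expRN (R : realType) :
  (\int[lebesgue_measure]_(s in `]0%R, +oo[) (s ^+ 5 * expR (- s) : R)%:E =
   (120 : R)%:E)%E.
Proof.
(* [p] is the sum of 5! / j! s^j over j <= 5, so p - p' = s^5 and [F] is an antiderivative of
   [f]. *)
pose p (s : R) :=
  s ^+ 5 + 5 * s ^+ 4 + 20 * s ^+ 3 + 60 * s ^+ 2 + 120 * s + 120.
pose F (s : R) := - (p s * expR (- s)).
pose f (s : R) := s ^+ 5 * expR (- s).
have dF (x : R) : is_derive x 1 F (f x).
  rewrite /F /p; apply: is_derive_eq.
  by rewrite /GRing.scale/= /f; ring.
have cF : continuous F.
  by move=> x; apply/differentiable_continuous/derivable1_diffP.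
have cf : continuous f.
  move=> x; apply/differentiable_continuous/derivable1_diffP.
  by rewrite /f; apply: ex_derive.
rewrite integral_itv_obnd_cbnd; last first.
  apply/measurable_EFinP/measurable_funTS; exact: continuous_measurable_fun.
rewrite (@ge0_continuous_FTC2y _ f F 0 0)//.
- rewrite /F /p !expr0n/= !mulr0 !add0r oppr0 expR0 mulr1.
  by rewrite opprK.
- by move=> x x0; rewrite mulr_ge0 ?exprn_ge0 ?expR_ge0.
- exact: continuous_subspaceT.
- rewrite (_ : F = fun s => - (s ^+ 5 * expR (- s) + 5 * (s ^+ 4 * expR (- s)) +
    20 * (s ^+ 3 * expR (- s)) + 60 * (s ^+ 2 * expR (- s)) +
    120 * (s ^+ 1 * expR (- s)) + 120 * (s ^+ 0 * expR (- s)))); last first.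
    by apply/funext => s; rewrite /F /p; ring.
  rewrite -[X in _ --> X](_ :
    - (0 + 5 * 0 + 20 * 0 + 60 * 0 + 120 * 0 + 120 * 0) = _); last by ring.
  have c (k : R) n : k * (x ^+ n * expR (- x)) @[x --> +oo] --> k * 0.
    by apply: cvgMr; exact: cvg_exprMexpRN.
  by apply: cvgN; apply: cvgD => //; apply: cvgD => //; apply: cvgD => //;
    apply: cvgD => //; apply: cvgD => //; exact: cvg_exprMexpRN.
- by apply: cvg_at_right_filter; exact: cF.
- by move=> x _; rewrite derive1E derive_val.
Qed.

(** Differentiability is asked only inside the interval, since [asin] and the square root fail it at
    1; a = b is allowed because the disc part may be empty. *)
Lemma integral_derive_oo (R : realType) (f F : R -> R) (a b : R) : a <= b ->
  {within `[a, b], continuous f} -> {within `[a, b], continuous F} ->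
  (forall x : R, a < x < b -> is_derive x 1 F (f x)) ->
  (\int[lebesgue_measure]_(x in `]a, b[) (f x)%:E = (F b - F a)%:E)%E.
Proof.
rewrite le_eqVlt => /predU1P[<- _ _ _|ab cf cF dF].
  by rewrite set_itvoo0 integral_set0 subrr.
have /(continuous_within_itvP _ ab)[_ Fa Fb] := cF.
rewrite -(@integral_itv_bndoo _ a b _ true false); last first.
  apply/measurable_EFinP; apply: open_continuous_measurable_fun => // x.
  rewrite inE => xab; have /(continuous_within_itvP _ ab)[cab _ _] := cf.
  exact: cab.
rewrite (@continuous_FTC2 _ f F a b ab cf)//.
- by split => // x; rewrite in_itv/= => /dF[].
- by move=> x; rewrite in_itv/= => /dF /@derive_val; rewrite derive1E.
Qed.

(** As the inverse of [sin] on a closed interval, [asin] is continuous up to the endpoints. *)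
Lemma within_continuous_asin (R : realType) :
  {within `[(-1), 1], continuous (@asin R)}.
Proof.
have pi20 : - (pi / 2) <= pi / 2 :> R by rewrite ge0_cp// divr_ge0// pi_ge0.
have := @segment_can_le_continuous R (- (pi / 2)) (pi / 2) sin asin.
rewrite sinN sin_pihalf; apply => //.
- by apply: continuous_subspaceT; exact: continuous_sin.
- exact: sinK.
Qed.

(** For u = sin (pi / 6) the triple-angle formula turns sin (pi / 2) = 1 into (u + 1) (2 u - 1)^2 =
    0, and u > 0 excludes the root -1. *)
Lemma sin_pi6 (R : realType) : sin (pi / 6) = 1 / 2 :> R.
Proof.
have pi0 : 0 < pi :> R := pi_gt0 R.
have u0 : 0 < sin (pi / 6) :> R.
  by apply: sin_gt0_pi; apply/andP; split; lra.
have : sin (pi / 6 + (pi / 6) *+ 2) = 1 :> R.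
  by rewrite -[RHS]sin_pihalf; congr sin; field.
rewrite sinD sin_mulr2n cos_mulr2n.
have := cos2sin2 (pi / 6 : R).
set u := sin _; set c := cos _ => cE.
rewrite (_ : _ + _ = u * (4 * c ^+ 2 - 1)); last by ring.
rewrite cE => h.
have /eqP : (u + 1) * (2 * u - 1) ^+ 2 = 0.
  lra.
rewrite mulf_eq0 expf_eq0/= => /orP[/eqP|/eqP]; last lra.
by have := u0; rewrite -/u; lra.
Qed.

Lemma asin_half (R : realType) : asin (1 / 2) = pi / 6 :> R.
Proof.
have pi0 : 0 < pi :> R := pi_gt0 R.
by rewrite -sin_pi6 sinK// in_itv/=; apply/andP; split; lra.
Qed.

Lemma asin1 (R : realType) : asin 1 = pi / 2 :> R.
Proof.
have pi0 : 0 < pi :> R := pi_gt0 R.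
by rewrite -[X in asin X]sin_pihalf sinK// in_itv/=; apply/andP; split; lra.
Qed.

Lemma integral_quad (R : realType) (a b H : R) : 0 <= H ->
  (\int[lebesgue_measure]_(h in `](- H)%R, H[) (a * (b - h ^+ 2))%:E =
   (a * (2 * b * H - 2 * H ^+ 3 / 3))%:E)%E.
Proof.
move=> H0; pose F (h : R) := a * (b * h - 1 / 3 * h ^+ 3).
have dF (x : R) : is_derive x 1 F (a * (b - x ^+ 2)).
  rewrite /F; apply: is_derive_eq.
  by rewrite /GRing.scale/=; field.
rewrite (@integral_derive_oo _ _ F); last 3 first.
- lra.
- apply: continuous_subspaceT => x.
  apply/differentiable_continuous/derivable1_diffP.
  exact: ex_derive.
- apply: continuous_subspaceT => x.
  apply/differentiable_continuous/derivable1_diffP.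
  exact: ex_derive.
by congr EFin; rewrite /F; field.
Qed.

(** * Integration over the sector of the disc *)

Section sector.
Context (R : realType) (k : R) (k0 : 0 < k) (k2 : k <= 2).
Local Notation mu := (@lebesgue_measure R).

(* With w = (1 - k y) / 3, [y] is the distance from the centre towards the side
   w = 0, in units of the radius of the disc; the two bounds come from the edges
   of the sector and from the circle. *)
Definition sector_halfwidth (y : R) : R :=
  Num.min (Num.sqrt 3 * y) (Num.sqrt (1 - y ^+ 2)).

(** Up to the factor [k / (108 * Num.sqrt 3)], this is what integrating [simplex_density] over h
    leaves at w = (1 - k y) / 3. *)
Definition sector_density (y : R) : R :=
  (1 - k * y) * ((2 + k * y) ^+ 2 * sector_halfwidth y
                 - k ^+ 2 * sector_halfwidth y ^+ 3).

(** The polynomial factor of [disc_density] expands to (4 - k^2) + k^3 y - 2 k^2 y^2 - 2 k^3 y^3.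
    Times the square root, the even monomials produce the arcsine and the odd ones the powers of 1 -
    y^2. *)
Definition disc_primitive (y : R) : R :=
  (2 - 3 * k ^+ 2 / 4) * asin y + Num.sqrt (1 - y ^+ 2) *
   ((4 - k ^+ 2) / 2 * y + k ^+ 2 / 4 * y * (1 - 2 * y ^+ 2)
    + k ^+ 3 / 3 * (1 - y ^+ 2) - 2 * k ^+ 3 / 5 * (1 - y ^+ 2) ^+ 2).

Definition disc_density (y : R) : R :=
  (1 - k * y) * ((2 + k * y) ^+ 2 - k ^+ 2 * (1 - y ^+ 2)) * Num.sqrt (1 - y ^+ 2).

Let sqrt1_gt0 (y : R) : -1 < y < 1 -> 0 < 1 - y ^+ 2.
Proof.
move=> /andP[? ?]; rewrite (_ : 1 - y ^+ 2 = (1 - y) * (1 + y)); last by ring.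
by rewrite mulr_gt0//; lra.
Qed.

Lemma is_derive_disc_primitive (y : R) : -1 < y < 1 ->
  is_derive y 1 disc_primitive (disc_density y).
Proof.
move=> y1; have y0 := sqrt1_gt0 y1.
have da := is_derive1_asin y1.
have ds : is_derive y 1 (fun y : R => Num.sqrt (1 - y ^+ 2))
    (- y / Num.sqrt (1 - y ^+ 2)).
  have dq : is_derive y 1 (fun y : R => 1 - y ^+ 2) (- (2 * y)).
    by apply: is_derive_eq; rewrite /GRing.scale/=; ring.
  have := @is_derive1_comp R Num.sqrt (fun y : R => 1 - y ^+ 2) y _ _
    (is_derive1_sqrt y0) dq.
  move=> h; apply: (is_derive_eq h).
  rewrite /GRing.scale/=; field.
  by rewrite gt_eqF// sqrtr_gt0.
rewrite /disc_primitive; apply: is_derive_eq.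
rewrite /GRing.scale/= /disc_density.
have r0 : Num.sqrt (1 - y ^+ 2) != 0 by rewrite gt_eqF// sqrtr_gt0.
have rE : Num.sqrt (1 - y ^+ 2) ^+ 2 = 1 - y ^+ 2 by rewrite sqr_sqrtr// ltW.
set r := Num.sqrt _ in r0 rE *.
(* Multiplying by [r] and replacing r^2 by 1 - y^2 leaves a polynomial identity. *)
have clear_r a b c e : a + b * (1 - y ^+ 2) + c * (- y) = e * (1 - y ^+ 2) ->
    a / r + (r * b + c * (- y / r)) = e * r.
  rewrite -rE => h; apply: (mulIf r0).
  rewrite [RHS](_ : _ = e * r ^+ 2); last by ring.
  by rewrite -h; field.
by apply: clear_r; field.
Qed.

Lemma continuous_sqrt1 : continuous (fun y : R => Num.sqrt (1 - y ^+ 2)).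
Proof.
move=> y; apply: continuous_comp; last exact: sqrt_continuous.
by apply: cvgB; [exact: cvg_cst|exact: exprn_continuous].
Qed.

Lemma within_continuous_disc_primitive (m : R) : m <= 1 ->
  {within `[1 / 2, m], continuous disc_primitive}.
Proof.
move=> m1; have sub : `[1 / 2, m] `<=` `[-1, 1].
  by move=> y /=; rewrite !in_itv/= => /andP[? ?]; apply/andP; split; lra.
have ca := continuous_subspaceW sub (@within_continuous_asin R).
pose p (y : R) := (4 - k ^+ 2) / 2 * y + k ^+ 2 / 4 * y * (1 - 2 * y ^+ 2)
    + k ^+ 3 / 3 * (1 - y ^+ 2) - 2 * k ^+ 3 / 5 * (1 - y ^+ 2) ^+ 2.
have cp : continuous p.
  move=> y; apply/differentiable_continuous/derivable1_diffP; exact: ex_derive.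
have cq : {within `[1 / 2, m],
    continuous (fun y => Num.sqrt (1 - y ^+ 2) * p y)}.
  apply: continuous_subspaceT => y.
  by apply: cvgM; [exact: continuous_sqrt1|exact: cp].
move=> y; apply: cvgD; last exact: cq.
by apply: cvgM; [exact: cvg_cst|exact: ca].
Qed.

Lemma integral_disc_density (m : R) : 1 / 2 <= m <= 1 ->
  (\int[mu]_(y in `](1 / 2)%R, m[) (disc_density y)%:E =
   (disc_primitive m - disc_primitive (1 / 2))%:E)%E.
Proof.
move=> /andP[m2 m1].
apply: (@integral_derive_oo _ disc_density disc_primitive (1 / 2) m m2).
- pose p (y : R) := (1 - k * y) * ((2 + k * y) ^+ 2 - k ^+ 2 * (1 - y ^+ 2)).
  have cp : continuous p.
    move=> y; apply/differentiable_continuous/derivable1_diffP; exact: ex_derive.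
  apply: continuous_subspaceT => y.
  by apply: cvgM; [exact: cp|exact: continuous_sqrt1].
- exact: within_continuous_disc_primitive.
- move=> y /andP[? ?]; apply: is_derive_disc_primitive.
  by apply/andP; split; lra.
Qed.

Definition triangle_density (y : R) : R :=
  Num.sqrt 3 * (4 * y - 6 * k ^+ 2 * y ^+ 3 + 2 * k ^+ 3 * y ^+ 4).

Lemma integral_triangle_density :
  (\int[mu]_(y in `]0%R, (1 / 2)%R[) (triangle_density y)%:E =
   (Num.sqrt 3 * (1 / 2 - 3 * k ^+ 2 / 32 + k ^+ 3 / 80))%:E)%E.
Proof.
pose F (y : R) := Num.sqrt 3 * (2 * y ^+ 2 - 3 / 2 * k ^+ 2 * y ^+ 4 +
  2 / 5 * k ^+ 3 * y ^+ 5).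
have dF (y : R) : is_derive y 1 F (triangle_density y).
  rewrite /F; apply: is_derive_eq.
  by rewrite /GRing.scale/= /triangle_density; field.
rewrite (@integral_derive_oo _ _ F)//.
- by congr EFin; rewrite /F; field.
- apply: continuous_subspaceT => x.
  apply/differentiable_continuous/derivable1_diffP.
  exact: ex_derive.
- apply: continuous_subspaceT => x.
  apply/differentiable_continuous/derivable1_diffP.
  exact: ex_derive.
Qed.

(** For y >= 0, squaring sqrt 3 y <= sqrt (1 - y^2) gives 4 y^2 <= 1: up to y = 1 / 2 the edges of
    the sector are the binding bound, and beyond it the circle. *)
Lemma sector_density_triangle (y : R) : 0 <= y <= 1 / 2 ->
  sector_density y = triangle_density y.
Proof.
move=> /andP[y0 y2]; rewrite /sector_density /sector_halfwidth.
have s3 : Num.sqrt 3 ^+ 2 = 3 :> R by rewrite sqr_sqrtr.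
have r2 : Num.sqrt (1 - y ^+ 2) ^+ 2 = 1 - y ^+ 2 by rewrite sqr_sqrtr//; nra.
rewrite min_l; last first.
  rewrite -(@ler_pXn2r _ 2) ?nnegrE ?mulr_ge0 ?sqrtr_ge0//.
  by rewrite exprMn s3 r2; nra.
by rewrite /triangle_density exprMn [Num.sqrt 3 ^+ 3]exprS s3; ring.
Qed.

Lemma sector_density_disc (y : R) : 1 / 2 <= y <= 1 ->
  sector_density y = disc_density y.
Proof.
move=> /andP[y2 y1]; rewrite /sector_density /sector_halfwidth.
have s3 : Num.sqrt 3 ^+ 2 = 3 :> R by rewrite sqr_sqrtr.
have r2 : Num.sqrt (1 - y ^+ 2) ^+ 2 = 1 - y ^+ 2 by rewrite sqr_sqrtr//; nra.
have y0 : 0 <= y by lra.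
rewrite min_r; last first.
  rewrite -(@ler_pXn2r _ 2) ?nnegrE ?mulr_ge0 ?sqrtr_ge0//.
  by rewrite exprMn s3 r2; nra.
by rewrite /disc_density [Num.sqrt (1 - y ^+ 2) ^+ 3]exprS r2; ring.
Qed.

Lemma sector_halfwidth_ge0 (y : R) : 0 <= y -> 0 <= sector_halfwidth y.
Proof.
by move=> y0; rewrite /sector_halfwidth le_min mulr_ge0 ?sqrtr_ge0.
Qed.

(** With h the half-width, the second factor is h (2 + k y - k h) (2 + k y + k h), and k h <= 2
    because k <= 2 and h <= 1. *)
Lemma sector_density_ge0 (y : R) : 0 <= y -> k * y <= 1 ->
  0 <= sector_density y.
Proof.
move=> y0 ky; have h0 := sector_halfwidth_ge0 y0.
have h1 : sector_halfwidth y <= 1.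
  rewrite /sector_halfwidth ge_min -[X in _ || (_ <= X)]sqrtr1.
  by rewrite ler_sqrt// gerBl sqr_ge0 orbT.
rewrite /sector_density; apply: mulr_ge0; first by rewrite subr_ge0.
set h := sector_halfwidth y in h0 h1 *.
rewrite (_ : _ - _ = h * ((2 + k * y - k * h) * (2 + k * y + k * h)));
  last by ring.
have ky0 : 0 <= k * y by rewrite mulr_ge0// ltW.
have kh0 : 0 <= k * h by rewrite mulr_ge0// ltW.
have kh2 : k * h <= 2 by rewrite (le_trans _ k2)// ler_piMr// ltW.
by rewrite !mulr_ge0//; lra.
Qed.

Lemma measurable_sector_density : measurable_fun setT sector_density.
Proof.
have mh : measurable_fun setT sector_halfwidth.
  apply: measurable_minr; first exact: measurable_funM.
  by apply: continuous_measurable_fun; exact: continuous_sqrt1.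
have mky : measurable_fun setT (fun y : R => k * y) by exact: measurable_funM.
apply: measurable_funM; first exact: measurable_funB.
apply: measurable_funB; apply: measurable_funM => //; apply: measurable_funX => //.
exact: measurable_funD.
Qed.

(** The interval is cut at 1 / 2, where the edges of the sector meet the circle. *)
Lemma integral_sector_density (m : R) : 1 / 2 <= m <= 1 -> k * m <= 1 ->
  (\int[mu]_(y in `]0%R, m[) (sector_density y)%:E =
   (Num.sqrt 3 * (1 / 2 - 3 * k ^+ 2 / 32 + k ^+ 3 / 80) +
    (disc_primitive m - disc_primitive (1 / 2)))%:E)%E.
Proof.
move=> /andP[m2 m1] km.
have mS D : measurable_fun D (EFin \o sector_density).
  apply/measurable_EFinP; apply: measurable_funTS.
  exact: measurable_sector_density.
have -> : `]0, m[%classic = `]0, 1 / 2[%classic `|` `[1 / 2, m[%classic :> set R.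
  apply/seteqP; split => y /=; rewrite !in_itv/=.
    move=> /andP[y0 ym].
    have [y2|y2] := ltP y (1 / 2); first by left; rewrite y0.
    by right; rewrite ym.
  by case=> /andP[? ?]; apply/andP; split; lra.
rewrite ge0_integral_setU//=.
- rewrite EFinD -integral_triangle_density -integral_disc_density ?m2//.
  congr (_ + _)%E.
    apply: eq_integral => y; rewrite inE/= in_itv/= => /andP[y0 y2].
    by rewrite sector_density_triangle// !ltW.
  rewrite (@integral_itv_bndoo _ (1 / 2) m _ true true)//.
  apply: eq_integral => y; rewrite inE/= in_itv/= => /andP[y0 y2].
  by rewrite sector_density_disc// (ltW y0) (ltW (lt_le_trans y2 m1)).
- exact: mS.
- move=> y yD; have /andP[y0 ym] : 0 <= y <= m.
    by case: yD => /=; rewrite in_itv/= => /andP[? ?]; apply/andP; split; lra.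
  by rewrite lee_fin sector_density_ge0// (le_trans _ km)// ler_pM2l.
- apply/disj_setPS => y /= -[]; rewrite !in_itv/= => /andP[_ y2] /andP[y2' _].
  by move: (lt_le_trans y2 y2'); rewrite ltxx.
Qed.

(** For fixed y the cone conditions confine h to a symmetric interval of half-length k / (2 sqrt 3)
    times [sector_halfwidth y], over which the integrand is quadratic in h. *)
Lemma integral_simplex_density_section (t y : R) : k ^+ 2 * t ^+ 2 = 2 ->
  (\int[mu]_h (simplex_density t ((1 - k * y) / 3)%R h)%:E =
   (if (0 < y) && (y < Num.min 1 k^-1) then
      k / (108 * Num.sqrt 3) * sector_density y else 0)%R%:E)%E.
Proof.
move=> kt; set w := (1 - k * y) / 3.
have k20 : 0 < k ^+ 2 by rewrite exprn_gt0.
have coneE h : cone t (w, h + (1 - w) / 2, (1 - w) / 2 - h) =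
    [&& - h < k * y / 2, h < k * y / 2 & 12 * h ^+ 2 < k ^+ 2 * (1 - y ^+ 2)].
  rewrite /cone (_ : w + _ + _ = 1); last by field.
  rewrite ltr01/= expr1n -[X in _ && (_ && X)](ltr_pM2l k20) mulrA kt.
  congr [&& _, _ & _].
  - by apply/idP/idP; rewrite /w; lra.
  - by apply/idP/idP; rewrite /w; lra.
  - rewrite (_ : 2 * _ = k ^+ 2 * y ^+ 2 + 12 * h ^+ 2).
      by apply/idP/idP; lra.
    by rewrite /w; field.
(* Outside the range of y the section is empty: the two linear bounds on h force y > 0, the circle
   forces y < 1, and w > 0 forces k y < 1. *)
case: ifPn => [/andP[y0]|]; last first.
  rewrite lt_min negb_and negb_and -!leNgt => ny; apply: integral0_eq => h _.
  rewrite /simplex_density coneE; case: ifPn => // /andP[w0 /and3P[h1 h2 h3]].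
  exfalso.
  have y0 : 0 < y by rewrite -(pmulr_rgt0 _ k0); lra.
  move: ny; rewrite leNgt y0/= => /orP[y1|ky].
    have : 1 - y ^+ 2 <= 0 by nra.
    by rewrite -(pmulr_rle0 _ k20) => ?; have := sqr_ge0 h; lra.
  have : 1 <= k * y by rewrite -(@divff _ k) ?gt_eqF// ler_pM2l.
  by move: w0; rewrite /w; lra.
rewrite lt_min => /andP[y1 ky].
have w0 : 0 < w.
  by rewrite divr_gt0// subr_gt0 -(@divff _ k) ?gt_eqF// ltr_pM2l.
have s30 : 0 < Num.sqrt 3 :> R by rewrite sqrtr_gt0.
have s3 : Num.sqrt 3 ^+ 2 = 3 :> R by rewrite sqr_sqrtr.
(* [c] converts units of the half-width into h: it sends sqrt 3 y to k y / 2, and 12 c^2 = k^2. *)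
pose c := k / (2 * Num.sqrt 3).
have c0 : 0 < c by rewrite divr_gt0// mulr_gt0.
have c2 : 12 * c ^+ 2 = k ^+ 2.
  by rewrite /c expr_div_n exprMn s3; field.
have cs : c * (Num.sqrt 3 * y) = k * y / 2.
  by rewrite /c; field; rewrite gt_eqF.
pose H := c * sector_halfwidth y.
have H0 : 0 <= H by rewrite mulr_ge0 ?(ltW c0)// sector_halfwidth_ge0// ltW.
have r2 : Num.sqrt (1 - y ^+ 2) ^+ 2 = 1 - y ^+ 2 by rewrite sqr_sqrtr//; nra.
have HE h : (h \in `](- H), H[) =
    [&& - h < k * y / 2, h < k * y / 2 & 12 * h ^+ 2 < k ^+ 2 * (1 - y ^+ 2)].
  rewrite in_itv/= -ltr_norml /H /sector_halfwidth minr_pMr ?(ltW c0)// cs lt_min.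
  rewrite ltr_norml ltrNl -andbA; congr [&& _, _ & _].
  rewrite -c2 -[in RHS]r2 -mulrA -exprMn ltr_pM2l//.
  rewrite -[in RHS]real_normK ?num_real//.
  by rewrite ltr_pXn2r// nnegrE mulr_ge0 ?sqrtr_ge0 ?(ltW c0).
transitivity (\int[mu]_(h in `](- H)%R, H[)
    (w * ((1 - w) ^+ 2 / 4 - h ^+ 2))%:E)%E.
  rewrite [RHS]integral_mkcond; apply: eq_integral => h _.
  rewrite patchE /simplex_density coneE w0 -HE mem_setE.
  by case: (h \in `](- H), H[).
rewrite integral_quad//; congr EFin.
rewrite /sector_density /H; set e := sector_halfwidth y.
rewrite (_ : (c * e) ^+ 3 = c * (k ^+ 2 / 12) * e ^+ 3); last first.
  by rewrite -c2; field.
by rewrite /c /w; field; rewrite gt_eqF.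
Qed.

Lemma integral_simplex_density (t m : R) : k ^+ 2 * t ^+ 2 = 2 ->
  m = Num.min 1 k^-1 ->
  (\int[mu]_w \int[mu]_h (simplex_density t w h)%:E =
   (k ^+ 2 / (324 * Num.sqrt 3) *
    (Num.sqrt 3 * (1 / 2 - 3 * k ^+ 2 / 32 + k ^+ 3 / 80) +
    (disc_primitive m - disc_primitive (1 / 2))))%:E)%E.
Proof.
move=> kt mE.
have k3 : - (k / 3) != 0 by rewrite oppr_eq0 mulf_neq0 ?invr_eq0// gt_eqF.
have sd0 w h : (0 <= (simplex_density t w h)%:E)%E.
  by rewrite lee_fin simplex_density_ge0.
rewrite (ge0_integral_affine (1 / 3) k3); last 2 first.
- apply: (@measurable_fun_fubini_tonelli_F _ _ _ _ R mu
    (fun q => (simplex_density t q.1 q.2)%:E)) => //.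
  apply/measurable_EFinP; exact: measurable_simplex_density.
- by move=> w; exact: integral_ge0.
have mbound : 1 / 2 <= m <= 1.
  rewrite mE le_min ge_min lexx orTb andbT; apply/andP; split; first lra.
  by rewrite div1r lef_pV2// posrE.
have km : k * m <= 1.
  by rewrite -(@divff _ k) ?gt_eqF// ler_pM2l// mE ge_min lexx orbT.
rewrite [RHS]EFinM -(integral_sector_density mbound km).
have s30 : 0 < Num.sqrt 3 :> R by rewrite sqrtr_gt0.
(* The factor k / 3 is the Jacobian of w = (1 - k y) / 3; the rest comes from the integral over
   h. *)
rewrite (_ : (k ^+ 2 / (324 * Num.sqrt 3)) =
    `|- (k / 3)| * (k / (108 * Num.sqrt 3))); last first.
  by rewrite normrN gtr0_norm ?divr_gt0//; field; rewrite gt_eqF.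
rewrite EFinM -muleA; congr (_ * _)%E.
rewrite -ge0_integralZl//; last 3 first.
- apply/measurable_EFinP; apply: measurable_funTS.
  exact: measurable_sector_density.
- move=> y /=; rewrite in_itv/= => /andP[y0 ym].
  rewrite lee_fin sector_density_ge0 ?(ltW y0)// (le_trans _ km)//.
  by rewrite ler_pM2l// ltW.
- by rewrite lee_fin divr_ge0 ?(ltW k0)// mulr_ge0// ltW.
rewrite [RHS]integral_mkcond; apply: eq_integral => y _.
rewrite (_ : - (k / 3) * y + 1 / 3 = (1 - k * y) / 3); last by field.
rewrite integral_simplex_density_section// -mE patchE mem_setE in_itv/=.
by case: ifPn.
Qed.

End sector.

(** * From the statistic to the cones *)

(** With s the sum and v = 3 (x^2 + y^2 + z^2) - s^2, the mean is s / 3 and the variance v / 9, so T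
    = s / sqrt v. Since v is the sum of the squared pairwise differences, x < y makes it
    positive. *)
Lemma lt_mean_sd_ratioE (R : realType) (d : measure_display)
    (T : measurableType d) (P : probability T R) (X : 'I_3 -> {RV P >-> R})
    (i j k : 'I_3) (t : R) (w : T) : uniq [:: i; j; k] -> 0 < t ->
  X i w < X j w -> X i w < X k w ->
  (t < mean_sd_ratio X w) = cone t (X i w, X j w, X k w).
Proof.
move=> uijk t0 ij ik.
have sumE (F : 'I_3 -> R) : \sum_(l < 3) F l = F i + F j + F k.
  have ijkE := mem_uniq3 uijk.
  rewrite (eq_bigl (mem [:: i; j; k])); last first.
    by move=> l; have := ijkE l; rewrite !inE => h; symmetry; exact: h.
  by rewrite -big_uniq//= !big_cons big_nil addr0 addrA.
rewrite /mean_sd_ratio /sample_sd /sample_variance sumE.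
have -> : sample_mean X w = (X i w + X j w + X k w) / 3.
  by rewrite /sample_mean sumE.
rewrite /cone ij ik /=.
set x := X i w in ij ik *; set y := X j w in ij *; set z := X k w in ik *.
set s := x + y + z.
set v := 3 * (x ^+ 2 + y ^+ 2 + z ^+ 2) - s ^+ 2.
have v0 : 0 < v.
  rewrite (_ : v = (x - y) ^+ 2 + (x - z) ^+ 2 + (y - z) ^+ 2); last first.
    by rewrite /v /s; ring.
  rewrite !ltr_pwDl ?sqr_ge0//.
  by rewrite exprn_even_gt0//= subr_eq0 lt_eqF.
rewrite (_ : (_ ^+ 2 + _ + _) / 3 = v / 3 ^+ 2); last by rewrite /v /s; field.
have v30 : 0 < Num.sqrt (v / 3 ^+ 2) by rewrite sqrtr_gt0 divr_gt0// exprn_gt0.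
rewrite ltr_pdivlMr//.
rewrite sqrtrM ?ltW// sqrtrV ?exprn_ge0// sqrtr_sqr ger0_norm//.
rewrite mulrA ltr_pM2r ?invr_gt0//.
(* If s <= 0 both sides are false because t > 0; otherwise the inequality may be squared. *)
have [s0|s0] := ltP 0 s; last first.
  by apply/negbTE; rewrite -leNgt (le_trans s0)// mulr_ge0 ?sqrtr_ge0// ltW.
rewrite -(@ltr_pXn2r _ 2) ?nnegrE ?(ltW s0) ?mulr_ge0 ?sqrtr_ge0 ?(ltW t0)//.
by rewrite exprMn sqr_sqrtr// ltW.
Qed.

Lemma measurable_lt_mean_sd_ratio (R : realType) (d : measure_display)
    (T : measurableType d) (P : probability T R) (n : nat)
    (X : 'I_n -> {RV P >-> R}) (t : R) :
  measurable [set w | t < mean_sd_ratio X w].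
Proof.
rewrite (_ : [set w | _] = mean_sd_ratio X @^-1` `]t, +oo[); last first.
  by apply/seteqP; split => w /=; rewrite in_itv/= andbT.
rewrite -[X in measurable X]setTI.
exact: (measurable_mean_sd_ratio X measurableT).
Qed.

Section decomposition.
Context (R : realType) (d : measure_display) (T : measurableType d)
  (P : probability T R) (X : 'I_3 -> {RV P >-> R})
  (indX : mutually_independent X)
  (densX : forall i : 'I_3, has_density (X i) (@gamma21_pdf R)).

(** In the iterated integral of the joint law, the innermost one is the mass of a single point,
    which is zero for a law with density. *)
Lemma probability_tie (i j k : 'I_3) : uniq [:: i; j; k] ->
  P [set w | X j w = X k w] = 0%E.
Proof.
move=> uijk; pose A := [set p : R * R * R | p.1.2 = p.2].
have mA : measurable A.
  rewrite (_ : A = (fun p : R * R * R => p.1.2 == p.2) @^-1` [set true]);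
    last first.
    by apply/seteqP; split => p /= /eqP.
  rewrite -[X in measurable X]setTI.
  apply: (@measurable_fun_eqr _ _ R setT (fun p : R * R * R => p.1.2) snd) => //.
    by apply: measurableT_comp.
have := joint_law3 indX uijk mA; rewrite /A/= => ->.
apply: integral0_eq => x _; apply: integral0_eq => y _.
under eq_integral => z _.
  rewrite indicE (_ : (_ \in _) = (z \in [set y])); last first.
    by apply/idP/idP; rewrite !inE/= => ->.
  rewrite -indicE.
  over.
rewrite integral_indic// setIT.
transitivity (distribution P (X k) [set y]) => //.
by rewrite densX// integral_set1.
Qed.

Lemma probability_cone (t : R) (i j k : 'I_3) : uniq [:: i; j; k] ->
  P [set w | cone t (X i w, X j w, X k w)] =
  (120%:E * \int[lebesgue_measure]_w \int[lebesgue_measure]_h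
     (simplex_density t w h)%:E)%E.
Proof.
move=> uijk; pose A : set (R * R * R) := [set p | cone t p].
have mA : measurable A.
  rewrite -[A]setTI; exact: (@measurable_cone R t _ [set true]).
rewrite -(integral_x5_expRN R) -cone_mass_simplex.
have mA1 : measurable_fun setT (EFin \o (\1_A : _ -> R)).
  by apply/measurable_EFinP; exact: measurable_indic.
have A10 p : (0 <= (EFin \o (\1_A : _ -> R)) p)%E by rewrite lee_fin.
have h := ge0_integral3_density mA1 A10 (@measurable_gamma21_pdf R)
  (@gamma21_pdf_ge0 R) (densX i) (densX j) (densX k).
rewrite (joint_law3 indX uijk mA) h.
apply: eq_integral => x _; apply: eq_integral => y _; apply: eq_integral => z _.
rewrite -EFinM /cone_density indicE; congr (((nat_of_bool _)%:R * _)%:E).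
by apply/idP/idP; rewrite inE.
Qed.

Lemma probability_gt_mean_sd_ratio (t : R) : 0 < t ->
  P [set w | t < mean_sd_ratio X w] =
  (360%:E * \int[lebesgue_measure]_w \int[lebesgue_measure]_h
     (simplex_density t w h)%:E)%E.
Proof.
move=> t0.
pose C i j k := [set w | cone t (X i w, X j w, X k w)].
pose tie j k := [set w | X j w = X k w].
pose i0 : 'I_3 := ord0; pose i1 : 'I_3 := inord 1; pose i2 : 'I_3 := ord_max.
have u012 : uniq [:: i0; i1; i2] by rewrite /= !inE -!val_eqE/= inordK.
have u102 : uniq [:: i1; i0; i2] by rewrite /= !inE -!val_eqE/= inordK.
have u201 : uniq [:: i2; i0; i1] by rewrite /= !inE -!val_eqE/= inordK.
have mC i j k : measurable (C i j k).
  have mX3 := measurable_triple (X i) (X j) (X k).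
  have mc := measurableT_comp (@measurable_cone R t) mX3.
  have := mc measurableT [set true]; rewrite setTI; exact.
have mtie i j : measurable (tie i j).
  rewrite (_ : tie i j = (fun w => X i w == X j w) @^-1` [set true]);
    last first.
    by apply/seteqP; split => w /= /eqP.
  rewrite -[X in measurable X]setTI.
  by apply: (@measurable_fun_eqr _ _ R setT (X i) (X j)).
(* Ties form a null set; adjoining it turns the partition by strict minimum into an exact equality
   of sets. *)
pose N := tie i0 i1 `|` tie i0 i2 `|` tie i1 i2.
have mN : measurable N by apply: measurableU => //; exact: measurableU.
have N0 : P N = 0%E.
  have t01 := probability_tie u201; have t02 := probability_tie u102.
  have t12 := probability_tie u012.
  by rewrite /N measureU0// ?measureU0//; exact: measurableU.
have mE := measurable_lt_mean_sd_ratio X t.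
have CE i j k : uniq [:: i; j; k] ->
    C i j k `<=` [set w | t < mean_sd_ratio X w].
  move=> u w /= cw; have /and4P[ij ik _ _] := cw.
  by rewrite (lt_mean_sd_ratioE u).
rewrite -(measureU0 mE mN N0).
have -> : [set w | t < mean_sd_ratio X w] `|` N =
    C i0 i1 i2 `|` C i1 i0 i2 `|` C i2 i0 i1 `|` N.
  apply/seteqP; split => w /=; last first.
    case=> [[[]|]|]; [| | |by right].
    - by move/(CE _ _ _ u012); left.
    - by move/(CE _ _ _ u102); left.
    - by move/(CE _ _ _ u201); left.
  case=> [Ew|]; last by right.
  have [e01|n01] := eqVneq (X i0 w) (X i1 w); first by right; left; left.
  have [e02|n02] := eqVneq (X i0 w) (X i2 w); first by right; left; right.
  have [e12|n12] := eqVneq (X i1 w) (X i2 w); first by right; right.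
  left; move: n01 n02 n12; rewrite !neq_lt.
  (* Two of the eight sign patterns are cyclic, hence contradictory; transitivity still places them
     in the cone of [i2]. *)
  move=> /orP[l01|l10] /orP[l02|l20] /orP[l12|l21].
  - by left; left; rewrite (lt_mean_sd_ratioE u012 t0 l01 l02) in Ew.
  - by left; left; rewrite (lt_mean_sd_ratioE u012 t0 l01 l02) in Ew.
  - by right; rewrite (lt_mean_sd_ratioE u201 t0 l20 (lt_trans l20 l01)) in Ew.
  - by right; rewrite (lt_mean_sd_ratioE u201 t0 l20 l21) in Ew.
  - by left; right; rewrite (lt_mean_sd_ratioE u102 t0 l10 l12) in Ew.
  - by right; rewrite (lt_mean_sd_ratioE u201 t0 (lt_trans l21 l10) l21) in Ew.
  - by left; right; rewrite (lt_mean_sd_ratioE u102 t0 l10 l12) in Ew.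
  - by right; rewrite (lt_mean_sd_ratioE u201 t0 l20 l21) in Ew.
rewrite measureU0//; last by apply: measurableU => //; exact: measurableU.
(* Two different variables cannot both be the strict minimum. *)
have dis i j k i' j' k' : (i' \in [:: j; k]) -> (i \in [:: j'; k']) ->
    C i j k `&` C i' j' k' = set0.
  move=> i'E iE; apply/seteqP; split => w //=.
  move=> -[/and4P[ij ik _ _] /and4P[i'j' i'k' _ _]].
  have l1 : X i w < X i' w by move: i'E; rewrite !inE => /orP[] /eqP ->.
  have l2 : X i' w < X i w by move: iE; rewrite !inE => /orP[] /eqP ->.
  by move: (lt_trans l1 l2); rewrite ltxx.
rewrite measureU//; [|exact: measurableU|]; last first.
  by rewrite setIUl !dis ?setU0// !inE eqxx ?orbT.
rewrite measureU//; last by rewrite dis// !inE eqxx ?orbT.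
set I := (\int[_]_w _)%E.
have CP i j k : uniq [:: i; j; k] -> P (C i j k) = (120%:E * I)%E.
  exact: probability_cone.
transitivity (120%:E * I + 120%:E * I + 120%:E * I)%E.
  by congr (_ + _ + _)%E; exact: CP.
have I0 : (0 <= I)%E.
  apply: integral_ge0 => w _; apply: integral_ge0 => h _.
  by rewrite lee_fin simplex_density_ge0.
rewrite -!ge0_muleDl ?lee_fin//.
by congr (_ * I)%E; rewrite -!EFinD; congr EFin; ring.
Qed.

End decomposition.

(** * Evaluation of the distribution function *)

(** The algebraic part is exactly the value in [integral_triangle_density], so the two cancel and
    only the arcsine term remains. *)
Lemma disc_primitive_half (R : realType) (k : R) :
  disc_primitive k (1 / 2) = (2 - 3 * k ^+ 2 / 4) * (pi / 6) +
    Num.sqrt 3 * (1 / 2 - 3 * k ^+ 2 / 32 + k ^+ 3 / 80).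
Proof.
rewrite /disc_primitive asin_half.
rewrite (_ : 1 - (1 / 2) ^+ 2 = 3 * 2^-1 ^+ 2); last by field.
rewrite sqrtrM// sqrtr_sqr ger0_norm ?invr_ge0//.
by field.
Qed.

Theorem proposition2 (R : realType) (d : measure_display) (T : measurableType d)
    (P : probability T R) (X : 'I_3 -> {RV P >-> R})
    (sampleX : random_sample X)
    (densX : forall i : 'I_3, has_density (X i) (@gamma21_pdf R)) :
  let G : R -> \bar R := cdf (mean_sd_ratio X : {RV P >-> R}) in
  forall t : R,
    (Num.sqrt 2 <= t ->
       G t = (1 - (10 * pi * (4 * t ^+ 2 - 3))
                    / (27 * Num.sqrt 3 * t ^+ 4))%:E)
    /\
    (Num.sqrt 2 / 2 <= t <= Num.sqrt 2 ->
       G t = ((Num.sqrt (2 - t ^+ 2) * (- 33 * t ^+ 4 - 13 * t ^+ 2 + 8)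
               + 5 * pi * t * (4 * t ^+ 2 - 3)
               - 30 * t * (4 * t ^+ 2 - 3) * asin (t / Num.sqrt 2))
              / (27 * Num.sqrt 3 * t ^+ 5) + 1)%:E).
Proof.
move=> G t.
have s2 : Num.sqrt 2 ^+ 2 = 2 :> R by rewrite sqr_sqrtr.
have s20 : 0 < Num.sqrt 2 :> R by rewrite sqrtr_gt0.
have s30 : 0 < Num.sqrt 3 :> R by rewrite sqrtr_gt0.
(* Common form of both cases, with k = sqrt 2 / t; the constant is 360 / (324 sqrt 3). *)
have GE : Num.sqrt 2 / 2 <= t ->
    G t = (1 - 10 / (9 * Num.sqrt 3) * (Num.sqrt 2 / t) ^+ 2 *
    (disc_primitive (Num.sqrt 2 / t) (Num.min 1 (Num.sqrt 2 / t)^-1) -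
     (2 - 3 * (Num.sqrt 2 / t) ^+ 2 / 4) * (pi / 6)))%:E.
  move=> t2; have t0 : 0 < t by apply: lt_le_trans t2; rewrite divr_gt0.
  set k := Num.sqrt 2 / t.
  have k0 : 0 < k by rewrite divr_gt0.
  have k2 : k <= 2 by rewrite ler_pdivrMr//; lra.
  have kt : k ^+ 2 * t ^+ 2 = 2 by rewrite -exprMn divfK ?gt_eqF.
  have mE := measurable_lt_mean_sd_ratio X t.
  have -> : G t = (1 - P [set w | (t < mean_sd_ratio X w)%R])%E.
    rewrite -probability_setC//; congr (P _).
    by apply/seteqP; split => w /=; rewrite in_itv/= leNgt => /negP.
  case: sampleX => indX _.
  rewrite (probability_gt_mean_sd_ratio indX densX t0).
  rewrite (integral_simplex_density k0 k2 kt erefl) disc_primitive_half.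
  rewrite -EFinM -EFinB; congr EFin.
  by field; rewrite gt_eqF.
split=> [t2|/andP[t2 t2']].
  have t0 : 0 < t by apply: lt_le_trans t2.
  rewrite GE; last by lra.
  (* Here k <= 1, so the upper limit is 1: the square root vanishes there and the arcsine is pi /
     2. *)
  rewrite min_l; last by rewrite invf_div ler_pdivlMr// mul1r.
  congr EFin; rewrite /disc_primitive asin1 expr1n subrr sqrtr0.
  rewrite expr_div_n s2.
  by field; rewrite !gt_eqF.
have t0 : 0 < t by apply: lt_le_trans t2; rewrite divr_gt0.
rewrite GE// min_r; last by rewrite invf_div ler_pdivrMr// mul1r.
congr EFin; rewrite invf_div /disc_primitive.
(* The upper limit is now 1 / k = u. Writing t = sqrt 2 u leaves an identity between rational
   expressions in u, the roots, pi and [asin u]. *)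
pose u := t / Num.sqrt 2; rewrite -/u.
have u0 : 0 < u by rewrite divr_gt0.
have tE : t = Num.sqrt 2 * u by rewrite /u mulrC divfK ?gt_eqF.
have -> : Num.sqrt 2 / t = u^-1 by rewrite /u invf_div.
have -> : Num.sqrt (2 - t ^+ 2) = Num.sqrt 2 * Num.sqrt (1 - u ^+ 2).
  by rewrite -sqrtrM//; congr Num.sqrt; rewrite tE exprMn s2; ring.
set r := Num.sqrt (1 - u ^+ 2); set a := asin u.
have t2E : t ^+ 2 = 2 * u ^+ 2 by rewrite tE exprMn s2.
have t4E : t ^+ 4 = 4 * u ^+ 4.
  by rewrite (exprM t 2 2) t2E; ring.
have t5E : t ^+ 5 = 4 * Num.sqrt 2 * u ^+ 5 by rewrite exprS t4E tE; ring.
rewrite t5E t4E t2E tE.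
by field; rewrite !gt_eqF.
Qed.
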